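(* Let $\mathbf L\in\mathbb R_+^{n\times k}$. Let $\mathbf p\in\Delta_n$ and $t\in\operatorname{argmin}_{t'\in[k]}\mathbf p^\top\boldsymbol\ell_{t'}$ (equivalently $\mathbf p\in\mathcal Q^{\mathbf L}_t$). Then \[ \mathrm{CCdim}(\mathbf L)\ \ge\ \|\mathbf p\|_0-\mu_{\mathcal Q^{\mathbf L}_t}(\mathbf p)-1 . \]
   Context: Notation: $[m]=\{1,\dots,m\}$; $\Delta_n=\{\mathbf p\in\mathbb R_+^n:\sum_i p_i=1\}$; $\|\mathbf p\|_0$ is the number of nonzero entries of $\mathbf p$. A loss matrix $\mathbf L\in\mathbb R_+^{n\times k}$ has columns $\boldsymbol\ell_t$, $t\in[k]$. Standing assumption: for each $t\in[k]$ there is $\mathbf p\in\Delta_n$ with $\operatorname{argmin}_{t'}\mathbf p^\top\boldsymbol\ell_{t'}=\{t\}$. Trigger probability set: $\mathcal Q^{\mathbf L}_t=\{\mathbf p\in\Delta_n: t\in\operatorname{argmin}_{t'\in[k]}\mathbf p^\top\boldsymbol\ell_{t'}\}$. For a convex set $\mathcal Q\subseteq\mathbb R^n$ and $\mathbf p\in\mathcal Q$, $\mathcal F_{\mathcal Q}(\mathbf p)=\{\mathbf v:\exists\epsilon_0>0,\ \mathbf p+\epsilon\mathbf v\in\mathcal Q\ \forall\epsilon\in(0,\epsilon_0)\}$ and $\mu_{\mathcal Q}(\mathbf p)=\dim(\mathcal F_{\mathcal Q}(\mathbf p)\cap(-\mathcal F_{\mathcal Q}(\mathbf p)))$. A surrogate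 loss $\boldsymbol\psi:\mathcal C\to\mathbb R_+^n$ ($\mathcal C\subseteq\mathbb R^d$ convex) is $\mathbf L$-calibrated if there is $\mathrm{pred}:\mathcal C\to[k]$ such that for all $\mathbf q\in\Delta_n$: $\inf_{\mathbf u\in\mathcal C:\mathrm{pred}(\mathbf u)\notin\operatorname{argmin}_{t}\mathbf q^\top\boldsymbol\ell_{t}}\mathbf q^\top\boldsymbol\psi(\mathbf u)>\inf_{\mathbf u\in\mathcal C}\mathbf q^\top\boldsymbol\psi(\mathbf u)$. $\mathrm{CCdim}(\mathbf L)$ is the smallest $d\in\mathbb Z_+$ for which there exist a convex set $\mathcal C\subseteq\mathbb R^d$ and a convex (componentwise convex) $\mathbf L$-calibrated surrogate $\boldsymbol\psi:\mathcal C\to\mathbb R_+^n$ ($\infty$ if none exists). *)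

(* Defs.v *)
From Stdlib Require Import Reals ZArith.
Open Scope R_scope.

(* Vectors in R^m are represented as functions nat -> R whose entries with
   index >= m are zero (see [in_Rn]); the index set [m] is {0,...,m-1}. *)

Fixpoint sumR (m : nat) (f : nat -> R) : R :=
  match m with O => 0 | S m' => sumR m' f + f m' end.

Definition in_Rn (m : nat) (v : nat -> R) : Prop :=
  forall i, (m <= i)%nat -> v i = 0.

Definition dot (n : nat) (p q : nat -> R) : R := sumR n (fun i => p i * q i).

Definition simplex (n : nat) (p : nat -> R) : Prop :=
  in_Rn n p /\ (forall i, (i < n)%nat -> 0 <= p i) /\ sumR n p = 1.

Fixpoint nnz (n : nat) (p : nat -> R) : nat :=
  match n with
  | O => O
  | S n' => (nnz n' p + (if Req_EM_T (p n') 0 then 0 else 1))%nat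
  end.

Definition col (L : nat -> nat -> R) (t : nat) : nat -> R := fun i => L i t.

Definition nonneg_loss (n k : nat) (L : nat -> nat -> R) : Prop :=
  forall i t, (i < n)%nat -> (t < k)%nat -> 0 <= L i t.

Definition in_argmin (n k : nat) (L : nat -> nat -> R) (q : nat -> R) (t : nat) : Prop :=
  (t < k)%nat /\ forall t', (t' < k)%nat -> dot n q (col L t) <= dot n q (col L t').

Definition standing_assumption (n k : nat) (L : nat -> nat -> R) : Prop :=
  forall t, (t < k)%nat ->
    exists p, simplex n p /\ forall t', in_argmin n k L p t' <-> t' = t.

Definition trigger_set (n k : nat) (L : nat -> nat -> R) (t : nat) (p : nat -> R) : Prop :=
  simplex n p /\ in_argmin n k L p t.

Definition feas_dirs (n : nat) (Q : (nat -> R) -> Prop) (p : nat -> R) (v : nat -> R) : Prop :=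
  in_Rn n v /\
  exists eps0, 0 < eps0 /\
    forall eps, 0 < eps < eps0 -> Q (fun i => p i + eps * v i).

Definition lin_indep (m : nat) (w : nat -> nat -> R) : Prop :=
  forall c : nat -> R,
    (forall i, sumR m (fun j => c j * w j i) = 0) ->
    forall j, (j < m)%nat -> c j = 0.

Definition dim_ge (S : (nat -> R) -> Prop) (m : nat) : Prop :=
  exists w : nat -> nat -> R, (forall j, (j < m)%nat -> S (w j)) /\ lin_indep m w.

Definition is_dim (S : (nat -> R) -> Prop) (m : nat) : Prop :=
  dim_ge S m /\ ~ dim_ge S (m + 1)%nat.

Definition is_mu (n : nat) (Q : (nat -> R) -> Prop) (p : nat -> R) (mu : nat) : Prop :=
  is_dim (fun v => feas_dirs n Q p v /\ feas_dirs n Q p (fun i => - v i)) mu.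

Definition convex_set (C : (nat -> R) -> Prop) : Prop :=
  forall u w lam, C u -> C w -> 0 <= lam <= 1 ->
    C (fun i => lam * u i + (1 - lam) * w i).

Definition convex_surrogate (n : nat) (C : (nat -> R) -> Prop)
    (psi : (nat -> R) -> nat -> R) : Prop :=
  (forall u, C u -> in_Rn n (psi u) /\ forall i, (i < n)%nat -> 0 <= psi u i) /\
  (forall i, (i < n)%nat -> forall u w lam, C u -> C w -> 0 <= lam <= 1 ->
     psi (fun j => lam * u j + (1 - lam) * w j) i
       <= lam * psi u i + (1 - lam) * psi w i).

(* L-calibration.  For q in Delta_n, the condition
     inf_{u in C, pred u notin argmin} q.psi(u) > inf_{u in C} q.psi(u)
   (infimum of the empty set = +infinity) is written literally as: there is a
   real c strictly separating the two infima, i.e. some u in C has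
   q.psi(u) < c while every u in C with pred u notin argmin has q.psi(u) >= c. *)
Definition calibrated (n k : nat) (L : nat -> nat -> R) (C : (nat -> R) -> Prop)
    (psi : (nat -> R) -> nat -> R) : Prop :=
  exists pred : (nat -> R) -> nat,
    (forall u, C u -> (pred u < k)%nat) /\
    forall q, simplex n q ->
      exists c : R,
        (exists u, C u /\ dot n q (psi u) < c) /\
        (forall u, C u -> ~ in_argmin n k L q (pred u) -> c <= dot n q (psi u)).

(* d is feasible for CCdim(L): there exist a convex C in R^d and a convex
   L-calibrated surrogate psi : C -> R_+^n.  CCdim(L) is the least feasible d
   (infinity if none). *)
Definition CC_feasible (n k : nat) (L : nat -> nat -> R) (d : nat) : Prop :=
  exists (C : (nat -> R) -> Prop) (psi : (nat -> R) -> nat -> R),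
    (forall u, C u -> in_Rn d u) /\ convex_set C /\
    convex_surrogate n C psi /\ calibrated n k L C psi.

(* Main.v *)
(** Write [G i u = p i * psi u i], so that perturbing [p] to
    [fun i => p i * (1 + y i)] changes [p . psi u] into
    [sum_i (1 + y i) * G i u].  If [u0] is optimal for [p] up to [e], iterating
    a sandwich theorem gives affine minorants [b i <= G i - G i u0] on [C] with
    [sum_i b i >= -e].  The linear parts of the [b i] impose only [d] equations
    on [y] for [sum_i y i * b i] to be constant, and then [u0] is [2e]-optimal
    for both [p + v] and [p - v], where [v i = p i * y i].  If
    [nnz n p >= mu + d + 2], such a unit [y] supported on the support of [p] can
    moreover be taken with [sum_i v i = 0] and orthogonal to a basis of the
    lineality space of the feasible directions.  Letting [e] tend to 0 along a
    convergent subsequence of the [y]'s, calibration gives a prediction that is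
    optimal at [p + v] and [p - v]; hence so is every optimal [t] at [p], and
    [v] belongs to the lineality space.  It is independent of the basis because
    [sum_i v i * y i > 0], contradicting the maximality of [mu]. *)

Require Import Defs.
From Stdlib Require Import Reals ZArith Lra Lia Classical.
From Stdlib Require Import FunctionalExtensionality ClassicalEpsilon.
Open Scope R_scope.

(** * Finite sums *)

Lemma sumR_ext m f g :
  (forall i, (i < m)%nat -> f i = g i) -> sumR m f = sumR m g.
Proof.
  induction m as [|m IH]; intros H; simpl; [reflexivity|].
  rewrite IH, (H m) by (intros; auto with arith). reflexivity.
Qed.

Lemma sumR_plus m f g :
  sumR m (fun i => f i + g i) = sumR m f + sumR m g.
Proof. induction m as [|m IH]; simpl; [|rewrite IH]; ring. Qed.

Lemma sumR_scal m a f : sumR m (fun i => a * f i) = a * sumR m f.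
Proof. induction m as [|m IH]; simpl; [|rewrite IH]; ring. Qed.

Lemma sumR_zero m f : (forall i, (i < m)%nat -> f i = 0) -> sumR m f = 0.
Proof.
  induction m as [|m IH]; intros H; simpl; [reflexivity|].
  rewrite IH, (H m) by (intros; auto with arith). ring.
Qed.

Lemma sumR_le m f g :
  (forall i, (i < m)%nat -> f i <= g i) -> sumR m f <= sumR m g.
Proof.
  induction m as [|m IH]; intros H; simpl; [lra|].
  apply Rplus_le_compat; auto with arith.
Qed.

Lemma sumR_nonneg m f : (forall i, (i < m)%nat -> 0 <= f i) -> 0 <= sumR m f.
Proof.
  intros H. rewrite <- (sumR_zero m (fun _ => 0)) by reflexivity.
  now apply sumR_le.
Qed.

Lemma sumR_ge_term m f i :
  (forall j, (j < m)%nat -> 0 <= f j) -> (i < m)%nat -> f i <= sumR m f.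
Proof.
  induction m as [|m IH]; intros H Hi; [lia|]; simpl.
  destruct (Nat.eq_dec i m) as [->|Hne].
  - assert (0 <= sumR m f) by (apply sumR_nonneg; auto with arith). lra.
  - assert (f i <= sumR m f) by (apply IH; [auto with arith | lia]).
    assert (0 <= f m) by auto with arith. lra.
Qed.

Lemma sumR_exchange m n (f : nat -> nat -> R) :
  sumR m (fun i => sumR n (fun j => f i j)) =
  sumR n (fun j => sumR m (fun i => f i j)).
Proof.
  induction m as [|m IH]; simpl.
  - now rewrite sumR_zero.
  - now rewrite IH, sumR_plus.
Qed.

Lemma sumR_single m f i0 :
  (i0 < m)%nat -> (forall i, i <> i0 -> f i = 0) -> sumR m f = f i0.
Proof.
  induction m as [|m IH]; intros Hi H; [lia|]; simpl.
  destruct (Nat.eq_dec i0 m) as [->|Hne].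
  - rewrite sumR_zero by (intros; apply H; lia). ring.
  - rewrite IH, (H m) by (auto; lia). ring.
Qed.

Lemma dot_plus_r n q x y :
  dot n q (fun i => x i + y i) = dot n q x + dot n q y.
Proof.
  unfold dot. rewrite <- sumR_plus. apply sumR_ext. intros; ring.
Qed.

Lemma dot_scal_r n q a x : dot n q (fun i => a * x i) = a * dot n q x.
Proof.
  unfold dot. rewrite <- sumR_scal. apply sumR_ext. intros; ring.
Qed.

Lemma dot_comm n x y : dot n x y = dot n y x.
Proof. apply sumR_ext. intros; ring. Qed.

(** * Underdetermined homogeneous linear systems *)

Lemma nnz_pos_ex n p : (0 < nnz n p)%nat -> exists i, (i < n)%nat /\ p i <> 0.
Proof.
  induction n as [|n IH]; simpl; intros H; [lia|].
  destruct (Req_EM_T (p n) 0) as [E|E].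
  - destruct IH as (i & Hi & Hp); [lia|]. exists i; split; [lia | exact Hp].
  - exists n; split; [lia | exact E].
Qed.

Lemma nnz_ext n p q :
  (forall i, (i < n)%nat -> p i = q i) -> nnz n p = nnz n q.
Proof.
  induction n as [|n IH]; intros H; simpl; [reflexivity|].
  rewrite IH, (H n) by auto with arith. reflexivity.
Qed.

Lemma nnz_clear n p i0 :
  (i0 < n)%nat -> p i0 <> 0 ->
  nnz n p = S (nnz n (fun i => if Nat.eq_dec i i0 then 0 else p i)).
Proof.
  induction n as [|n IH]; intros Hi Hp; [lia|]; simpl.
  destruct (Nat.eq_dec n i0) as [->|Hne].
  - rewrite (nnz_ext i0 (fun i => if Nat.eq_dec i i0 then 0 else p i) p).
    + destruct (Req_EM_T (p i0) 0); [contradiction|].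
      destruct (Req_EM_T 0 0); [lia | lra].
    + intros i Hlt. destruct (Nat.eq_dec i i0); [lia | reflexivity].
  - rewrite IH by (auto; lia). destruct (Req_EM_T (p n) 0); lia.
Qed.

(* Gaussian elimination; clearing the entry [i0] of the mask [p] removes the
   unknown [i0]. *)
Lemma homogeneous_system_solution n E : forall (p : nat -> R) (A : nat -> nat -> R),
  (E < nnz n p)%nat ->
  exists y : nat -> R,
    (forall i, p i = 0 -> y i = 0) /\
    (exists i, (i < n)%nat /\ y i <> 0) /\
    (forall r, (r < E)%nat -> dot n (A r) y = 0).
Proof.
  induction E as [|E IH]; intros p A HE.
  - destruct (nnz_pos_ex n p HE) as (i0 & Hi0 & Hp).
    exists (fun i => if Nat.eq_dec i i0 then 1 else 0). split; [|split].
    + intros i Hi. destruct (Nat.eq_dec i i0); [congruence | reflexivity].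
    + exists i0; split; [exact Hi0|]. destruct (Nat.eq_dec i0 i0); [lra | lia].
    + intros r Hr; lia.
  - destruct (classic (exists i0, (i0 < n)%nat /\ p i0 <> 0 /\ A E i0 <> 0))
      as [(i0 & Hi0 & Hp0 & HA0)|Hno].
    + pose (p' := fun i => if Nat.eq_dec i i0 then 0 else p i).
      (* [A E i0] is the pivot: subtracting a multiple of row [E] clears column [i0] from every row
         [r]. *)
      pose (A' := fun r i => A r i + (- (A r i0 / A E i0)) * A E i).
      destruct (IH p' A') as (y & Hy0 & (i1 & Hi1 & Hne) & Hsys).
      { rewrite (nnz_clear n p i0 Hi0 Hp0) in HE. unfold p'. lia. }
      assert (Hyi0 : y i0 = 0).
      { apply Hy0. unfold p'. destruct (Nat.eq_dec i0 i0); [reflexivity | lia]. }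
      (* Since [y i0 = 0], the entry [i0] is still free; this value solves equation [E], and the
         eliminated rows then hold too. *)
      pose (a := - (dot n (A E) y / A E i0)).
      pose (e := fun i => if Nat.eq_dec i i0 then 1 else 0).
      assert (He : forall r, dot n (A r) e = A r i0).
      { intros r. unfold dot. rewrite (sumR_single n _ i0 Hi0).
        - unfold e. destruct (Nat.eq_dec i0 i0); [ring | lia].
        - intros i Hi. unfold e. destruct (Nat.eq_dec i i0); [lia | ring]. }
      assert (HA' : forall r, (r < E)%nat ->
                dot n (A r) y = A r i0 / A E i0 * dot n (A E) y).
      { intros r Hr. specialize (Hsys r Hr). unfold A' in Hsys.
        rewrite dot_comm, dot_plus_r, dot_scal_r in Hsys.
        rewrite (dot_comm n y (A r)), (dot_comm n y (A E)) in Hsys. lra. }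
      exists (fun i => y i + a * e i). split; [|split].
      * intros i Hi. unfold e. destruct (Nat.eq_dec i i0) as [->|Hn]; [contradiction|].
        rewrite Hy0; [ring|]. unfold p'. destruct (Nat.eq_dec i i0); [lia | exact Hi].
      * exists i1; split; [exact Hi1|]. unfold e.
        destruct (Nat.eq_dec i1 i0) as [->|Hn]; [contradiction | lra].
      * intros r Hr. rewrite dot_plus_r, dot_scal_r, He.
        destruct (Nat.eq_dec r E) as [->|Hn].
        -- unfold a. field. exact HA0.
        -- rewrite HA' by lia. unfold a. field. exact HA0.
    (* Without a pivot, row [E] vanishes on the support of [p], so any solution supported there
       satisfies it. *)
    + destruct (IH p A) as (y & Hy0 & Hne & Hsys); [lia|].
      exists y; split; [exact Hy0|]; split; [exact Hne|].
      intros r Hr. destruct (Nat.eq_dec r E) as [->|Hn]; [|apply Hsys; lia].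
      apply sumR_zero. intros i Hi.
      destruct (Req_dec (p i) 0) as [Hp|Hp]; [rewrite (Hy0 i Hp); ring|].
      destruct (Req_dec (A E i) 0) as [HA|HA]; [rewrite HA; ring|].
      exfalso; apply Hno; now exists i.
Qed.

(** Normalizing bounds the entries, which allows extracting limits, and keeps the limit away from
    zero. *)
Lemma homogeneous_system_unit_solution n E (p : nat -> R) (A : nat -> nat -> R) :
  (E < nnz n p)%nat ->
  exists y : nat -> R,
    (forall i, p i = 0 -> y i = 0) /\ dot n y y = 1 /\
    (forall r, (r < E)%nat -> dot n (A r) y = 0).
Proof.
  intros HE.
  destruct (homogeneous_system_solution n E p A HE) as (y & Hy0 & (i & Hi & Hne) & Hsys).
  assert (Hpos : 0 < dot n y y).
  { apply Rlt_le_trans with (y i * y i); [nra|].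
    apply (sumR_ge_term n (fun j => y j * y j)); [intros; nra | exact Hi]. }
  assert (Hs : sqrt (dot n y y) * sqrt (dot n y y) = dot n y y) by (apply sqrt_sqrt; lra).
  assert (Hs0 : 0 < sqrt (dot n y y)) by now apply sqrt_lt_R0.
  set (q := sqrt (dot n y y)) in *. clearbody q.
  exists (fun j => / q * y j). split; [|split].
  - intros j Hj. rewrite (Hy0 j Hj). ring.
  - rewrite dot_scal_r, dot_comm, dot_scal_r.
    rewrite <- Hs. field. lra.
  - intros r Hr. rewrite dot_scal_r, Hsys by exact Hr. ring.
Qed.

(** * Affine separation *)

Definition convex_on (C : (nat -> R) -> Prop) (f : (nat -> R) -> R) : Prop :=
  forall u w lam, C u -> C w -> 0 <= lam <= 1 ->
    f (fun j => lam * u j + (1 - lam) * w j) <= lam * f u + (1 - lam) * f w.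

(* One step of Hahn-Banach.  The symmetry hypothesis guarantees that the slopes
   [r / x d] are constrained from both sides or not at all. *)
Lemma slope_ex d (M : (nat -> R) -> R -> Prop) :
  (forall x r x' r' lam, M x r -> M x' r' -> 0 <= lam <= 1 ->
     M (fun j => lam * x j + (1 - lam) * x' j) (lam * r + (1 - lam) * r')) ->
  (forall x r, M x r -> exists r', M (fun j => - x j) r') ->
  (forall x r, M x r -> (forall j, (j < S d)%nat -> x j = 0) -> 0 <= r) ->
  exists a, forall x r, M x r -> (forall j, (j < d)%nat -> x j = 0) -> a * x d <= r.
Proof.
  intros Hconv Hsym Hzero.
  assert (Hxd0 : forall x r, M x r -> (forall j, (j < d)%nat -> x j = 0) ->
            x d = 0 -> 0 <= r).
  { intros x r HM Hx Hd. apply (Hzero x r HM). intros j Hj.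
    destruct (Nat.eq_dec j d) as [->|]; [exact Hd | apply Hx; lia]. }
  assert (Hcross : forall x r x' r', M x r -> M x' r' ->
            (forall j, (j < d)%nat -> x j = 0) ->
            (forall j, (j < d)%nat -> x' j = 0) ->
            0 < x d -> x' d < 0 -> r' / x' d <= r / x d).
  { intros x r x' r' HM HM' Hx Hx' Hp Hn.
    (* The weight for which the convex combination has coordinate [d] equal to zero. *)
    set (lam := - x' d / (x d - x' d)).
    assert (Hl : lam * (x d - x' d) = - x' d) by (unfold lam; field; lra).
    assert (0 <= lam <= 1).
    { split; [unfold lam; apply Rmult_le_pos; [lra|];
              apply Rlt_le, Rinv_0_lt_compat; lra | nra]. }
    assert (H0 : 0 <= lam * r + (1 - lam) * r').
    { apply (Hxd0 (fun j => lam * x j + (1 - lam) * x' j)).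
      - now apply Hconv.
      - intros j Hj. rewrite Hx, Hx' by exact Hj. ring.
      - lra. }
    assert (H1 : 0 <= (- x' d) * r + x d * r').
    { replace (- x' d * r + x d * r')
        with ((x d - x' d) * (lam * r + (1 - lam) * r')).
      - apply Rmult_le_pos; lra.
      - transitivity (lam * (x d - x' d) * r + (x d - x' d - lam * (x d - x' d)) * r').
        + ring.
        + rewrite Hl. ring. }
    assert (H2 : r / x d - r' / x' d = (- x' d * r + x d * r') * / (x d * - x' d))
      by (field; lra).
    assert (0 <= (- x' d * r + x d * r') * / (x d * - x' d)).
    { apply Rmult_le_pos; [exact H1|]. apply Rlt_le, Rinv_0_lt_compat. nra. }
    lra. }
  destruct (classic (exists x r, M x r /\ (forall j, (j < d)%nat -> x j = 0) /\ x d < 0))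
    as [(x0 & r0 & HM0 & Hx0 & Hn0)|Hno].
  (* [P] collects the lower bounds that points with [x d < 0] put on the slope; [a] is their
     supremum. *)
  - pose (P := fun s => exists x r, M x r /\ (forall j, (j < d)%nat -> x j = 0) /\
                          x d < 0 /\ s = r / x d).
    destruct (completeness P) as (a & Hub & Hlub).
    + destruct (Hsym x0 r0 HM0) as (r1 & HM1).
      (* The reflection of [x0] has a positive coordinate [d], so by [Hcross] its quotient bounds
         all of [P]. *)
      exists (r1 / - x0 d). intros s (x & r & HM & Hx & Hn & ->).
      apply (Hcross (fun j => - x0 j) r1 x r HM1 HM); [|exact Hx|lra|exact Hn].
      intros j Hj. rewrite Hx0 by exact Hj. ring.
    + exists (r0 / x0 d), x0, r0. auto.
    + exists a. intros x r HM Hx.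
      destruct (Rtotal_order (x d) 0) as [Hn|[Hz|Hp]].
      * assert (r / x d <= a) by (apply Hub; now exists x, r).
        assert (r = r / x d * x d) by (field; lra). nra.
      * rewrite Hz, Rmult_0_r. now apply (Hxd0 x).
      * assert (a <= r / x d).
        { apply Hlub. intros s (x' & r' & HM' & Hx' & Hn' & ->).
          now apply Hcross. }
        assert (r = r / x d * x d) by (field; lra). nra.
  (* No point of the slice has a negative coordinate [d], hence by symmetry none has a positive one,
     and any slope would do. *)
  - exists 0. intros x r HM Hx. rewrite Rmult_0_l.
    apply (Hxd0 x r HM Hx).
    destruct (Rtotal_order (x d) 0) as [Hn|[Hz|Hp]]; [|exact Hz|];
      exfalso; apply Hno.
    + now exists x, r.
    + destruct (Hsym x r HM) as (r' & HM'). exists (fun j => - x j), r'.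
      split; [exact HM'|]. split; [|lra].
      intros j Hj. rewrite Hx by exact Hj. ring.
Qed.

(** [M] acts as the epigraph of a convex function that is nonnegative at the origin; symmetry of its
    domain replaces the usual interior-point condition. Each induction step fixes the slope in the
    last coordinate and subtracts that linear term. *)
Lemma linear_minorant d : forall M : (nat -> R) -> R -> Prop,
  (forall x r x' r' lam, M x r -> M x' r' -> 0 <= lam <= 1 ->
     M (fun j => lam * x j + (1 - lam) * x' j) (lam * r + (1 - lam) * r')) ->
  (forall x r, M x r -> exists r', M (fun j => - x j) r') ->
  (forall x r, M x r -> (forall j, (j < d)%nat -> x j = 0) -> 0 <= r) ->
  exists w, forall x r, M x r -> dot d w x <= r.
Proof.
  induction d as [|d IH]; intros M Hconv Hsym Hzero.
  - exists (fun _ => 0). intros x r HM. apply (Hzero x r HM). intros; lia.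
  - destruct (slope_ex d M Hconv Hsym Hzero) as (a & Ha).
    destruct (IH (fun x r => M x (r + a * x d))) as (w & Hw).
    + intros x r x' r' lam HM HM' Hlam.
      replace (lam * r + (1 - lam) * r' + a * (lam * x d + (1 - lam) * x' d))
        with (lam * (r + a * x d) + (1 - lam) * (r' + a * x' d)) by ring.
      now apply Hconv.
    + intros x r HM. destruct (Hsym _ _ HM) as (r' & HM').
      exists (r' - a * - x d).
      now replace (r' - a * - x d + a * - x d) with r' by ring.
    + intros x r HM Hx. specialize (Ha _ _ HM Hx). lra.
    + exists (fun j => if Nat.eq_dec j d then a else w j). intros x r HM.
      assert (H : dot d w x <= r - a * x d).
      { apply Hw. now replace (r - a * x d + a * x d) with r by ring. }
      unfold dot in *. simpl. destruct (Nat.eq_dec d d) as [_|]; [|lia].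
      rewrite (sumR_ext d _ (fun i => w i * x i)); [lra|].
      intros i Hi. destruct (Nat.eq_dec i d); [lia | reflexivity].
Qed.

(** The linear minorant is taken over differences [u - u'] with values at least [f u - g u']: their
    domain is symmetric for every [C]. It separates all values of [g - w] from all values of
    [f - w], and [c] is the supremum of the former. *)
Lemma affine_sandwich d (C : (nat -> R) -> Prop) (f g : (nat -> R) -> R) :
  (forall u, C u -> in_Rn d u) -> convex_set C ->
  convex_on C f -> convex_on C (fun u => - g u) ->
  (forall u, C u -> g u <= f u) ->
  exists w c, forall u, C u -> g u <= dot d w u + c <= f u.
Proof.
  intros Hd HC Hf Hg Hgf.
  destruct (linear_minorant d (fun x r => exists u u', C u /\ C u' /\
     (forall j, x j = u j - u' j) /\ f u - g u' <= r)) as (w & Hw).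
  - intros x r x' r' lam (u1 & u2 & H1 & H2 & Hx & Hr) (v1 & v2 & K1 & K2 & Hx' & Hr') Hl.
    exists (fun j => lam * u1 j + (1 - lam) * v1 j),
           (fun j => lam * u2 j + (1 - lam) * v2 j).
    split; [now apply HC|]. split; [now apply HC|]. split.
    + intros j. rewrite Hx, Hx'. ring.
    + specialize (Hf u1 v1 lam H1 K1 Hl). specialize (Hg u2 v2 lam H2 K2 Hl).
      cbv beta in Hg. nra.
  - intros x r (u & u' & Hu & Hu' & Hx & _).
    exists (f u' - g u), u', u. repeat split; auto; [|lra].
    intros j. rewrite Hx. ring.
  - intros x r (u & u' & Hu & Hu' & Hx & Hr) H0.
    (* Entries from index [d] on vanish on [C], so agreement in the first [d] coordinates is
       equality of functions. *)
    assert (u = u') as <-.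
    { apply functional_extensionality. intros j.
      destruct (le_lt_dec d j) as [Hj|Hj].
      - now rewrite (Hd u Hu j Hj), (Hd u' Hu' j Hj).
      - specialize (Hx j). rewrite (H0 j Hj) in Hx. lra. }
    specialize (Hgf u Hu). lra.
  - assert (Hw' : forall u u', C u -> C u' ->
              g u' - dot d w u' <= f u - dot d w u).
    { intros u u' Hu Hu'.
      assert (H : dot d w (fun j => u j + -1 * u' j) <= f u - g u').
      { apply Hw. exists u, u'. repeat split; auto; [|lra]. intros; ring. }
      rewrite dot_plus_r, dot_scal_r in H. lra. }
    destruct (classic (exists u, C u)) as [[u0 H0]|Hno].
    + destruct (completeness (fun s => exists u, C u /\ s = g u - dot d w u))
        as (c & Hub & Hlub).
      * exists (f u0 - dot d w u0). intros s (u & Hu & ->). now apply Hw'.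
      * now exists (g u0 - dot d w u0), u0.
      * exists w, c. intros u Hu. split.
        -- assert (g u - dot d w u <= c) by (apply Hub; now exists u). lra.
        -- assert (c <= f u - dot d w u); [|lra].
           apply Hlub. intros s (u' & Hu' & ->). now apply Hw'.
    + exists w, 0. intros u Hu. exfalso; apply Hno; now exists u.
Qed.

Lemma convex_on_plus C f g :
  convex_on C f -> convex_on C g -> convex_on C (fun u => f u + g u).
Proof.
  intros Hf Hg u w lam Hu Hw Hl.
  specialize (Hf u w lam Hu Hw Hl). specialize (Hg u w lam Hu Hw Hl). lra.
Qed.

Lemma convex_on_affine d C w c : convex_on C (fun u => dot d w u + c).
Proof.
  intros u v lam _ _ _. rewrite dot_plus_r, !dot_scal_r. lra.
Qed.

Lemma convex_on_sum m C (f : nat -> (nat -> R) -> R) :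
  (forall i, (i < m)%nat -> convex_on C (f i)) ->
  convex_on C (fun u => sumR m (fun i => f i u)).
Proof.
  induction m as [|m IH]; intros H; simpl.
  - intros u w lam _ _ _. lra.
  - apply (convex_on_plus C (fun u => sumR m (fun i => f i u))); auto with arith.
Qed.

(** Induction replaces one function at a time; [h] absorbs those whose turn has not come, so it must
    be an arbitrary convex function. *)
Lemma affine_minorants d C n (g : nat -> (nat -> R) -> R) :
  (forall u, C u -> in_Rn d u) -> convex_set C ->
  (forall i, (i < n)%nat -> convex_on C (g i)) ->
  forall h, convex_on C h ->
  (forall u, C u -> 0 <= sumR n (fun i => g i u) + h u) ->
  exists (w : nat -> nat -> R) (c : nat -> R),
    (forall i u, (i < n)%nat -> C u -> dot d (w i) u + c i <= g i u) /\
    (forall u, C u -> 0 <= sumR n (fun i => dot d (w i) u + c i) + h u).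
Proof.
  intros Hd HC. induction n as [|n IH]; intros Hg h Hh Hpos.
  - exists (fun _ _ => 0), (fun _ => 0). split; [intros; lia | exact Hpos].
  - destruct (IH (fun i Hi => Hg i (Nat.lt_lt_succ_r _ _ Hi))
                 (fun u => g n u + h u)) as (w & c & Hle & Hsum).
    + apply convex_on_plus; auto with arith.
    + intros u Hu. specialize (Hpos u Hu). simpl in Hpos. lra.
    (* Minus the remaining sum is concave and lies below [g n]; an affine function in between is the
       last minorant. *)
    + destruct (affine_sandwich d C (g n)
         (fun u => - (sumR n (fun i => dot d (w i) u + c i) + h u)))
        as (wn & cn & Hn); auto with arith.
      * intros u v lam Hu Hv Hl. rewrite !Ropp_involutive.
        apply (convex_on_plus C (fun u => sumR n (fun i => dot d (w i) u + c i)));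
          auto. apply convex_on_sum. intros i _. apply convex_on_affine.
      * intros u Hu. specialize (Hsum u Hu). cbv beta in Hsum. lra.
      * exists (fun i => if Nat.eq_dec i n then wn else w i),
               (fun i => if Nat.eq_dec i n then cn else c i). split.
        -- intros i u Hi Hu. destruct (Nat.eq_dec i n) as [->|Hne].
           ++ apply Hn; exact Hu.
           ++ apply Hle; [lia | exact Hu].
        -- intros u Hu. simpl. destruct (Nat.eq_dec n n) as [_|]; [|lia].
           rewrite (sumR_ext n _ (fun i => dot d (w i) u + c i)).
           ++ specialize (Hn u Hu). cbv beta in Hn. lra.
           ++ intros i Hi. destruct (Nat.eq_dec i n); [lia | reflexivity].
Qed.

(** * Near-optimal perturbation directions *)

(** The coefficient of [u j] in the weighted sum is [sum_i w i j * y i], so [d] equations on [y]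
    remove all dependence on [u]. *)
Lemma sumR_dot_affine n d y (w : nat -> nat -> R) c u :
  (forall j, (j < d)%nat -> dot n (fun i => w i j) y = 0) ->
  sumR n (fun i => y i * (dot d (w i) u + c i)) = sumR n (fun i => y i * c i).
Proof.
  intros Hw.
  rewrite (sumR_ext n _ (fun i => sumR d (fun j => u j * (w i j * y i)) + y i * c i)).
  - rewrite sumR_plus, sumR_exchange, sumR_zero; [ring|].
    intros j Hj. rewrite sumR_scal. fold (dot n (fun i => w i j) y).
    rewrite Hw by exact Hj. ring.
  - intros i _. rewrite (sumR_ext d _ (fun j => y i * (w i j * u j))) by (intros; ring).
    rewrite sumR_scal. unfold dot. ring.
Qed.

Lemma dot_self_entry_bound n y i : dot n y y = 1 -> (i < n)%nat -> -1 <= y i <= 1.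
Proof.
  intros H Hi.
  assert (y i * y i <= 1).
  { rewrite <- H. apply (sumR_ge_term n (fun j => y j * y j)); [intros; nra | exact Hi]. }
  nra.
Qed.

(** One [e] is lost in bounding the sum of the minorants at [u], the other in bounding their
    [y]-weighted sum, which is the same at [u] and [u0]. *)
Lemma near_optimal_direction d C n (G : nat -> (nat -> R) -> R) u0 e p E B :
  (forall u, C u -> in_Rn d u) -> convex_set C ->
  (forall i, (i < n)%nat -> convex_on C (G i)) -> C u0 ->
  (forall u, C u -> sumR n (fun i => G i u0) <= sumR n (fun i => G i u) + e) ->
  (E + d < nnz n p)%nat ->
  exists y : nat -> R,
    (forall i, p i = 0 -> y i = 0) /\ dot n y y = 1 /\
    (forall r, (r < E)%nat -> dot n (B r) y = 0) /\
    (forall s u, -1 <= s <= 1 -> C u ->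
       sumR n (fun i => (1 + s * y i) * G i u0) <=
       sumR n (fun i => (1 + s * y i) * G i u) + 2 * e).
Proof.
  intros Hd HC HG Hu0 Hopt HE.
  destruct (affine_minorants d C n (fun i u => G i u + - G i u0) Hd HC) with
    (h := fun _ : nat -> R => e) as (w & c & Hle & Hsum).
  - intros i Hi. apply convex_on_plus; [now apply HG|].
    intros u v lam _ _ _. lra.
  - intros u v lam _ _ _. lra.
  - intros u Hu. specialize (Hopt u Hu).
    rewrite sumR_plus, (sumR_ext n (fun i => - G i u0) (fun i => -1 * G i u0))
      by (intros; ring).
    rewrite sumR_scal. lra.
  - destruct (homogeneous_system_unit_solution n (E + d) p
       (* The first [E] equations are those of [B]; the next [d] cancel the slopes of the
          minorants. *)
       (fun r i => if lt_dec r E then B r i else w i (r - E)%nat) HE)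
      as (y & Hy0 & Hy1 & Hsys).
    exists y. split; [exact Hy0|]. split; [exact Hy1|]. split.
    + intros r Hr. rewrite <- (Hsys r) by lia. apply sumR_ext. intros i _.
      destruct (lt_dec r E); [reflexivity | lia].
    + assert (Hw : forall j, (j < d)%nat -> dot n (fun i => w i j) y = 0).
      { intros j Hj. rewrite <- (Hsys (E + j)%nat) by lia. apply sumR_ext. intros i _.
        destruct (lt_dec (E + j) E); [lia|].
        now replace (E + j - E)%nat with j by lia. }
      intros s u Hs Hu.
      pose (b := fun i u => dot d (w i) u + c i).
      assert (Hconst : sumR n (fun i => y i * b i u) = sumR n (fun i => y i * b i u0)).
      { unfold b. now rewrite !(sumR_dot_affine n d y w c). }
      assert (Hbu : 0 <= sumR n (fun i => b i u) + e) by now apply Hsum.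
      assert (Hbu0 : 0 <= sumR n (fun i => b i u0) + e) by now apply Hsum.
      assert (Hys : forall i, (i < n)%nat -> -1 <= s * y i <= 1).
      { intros i Hi. pose proof (dot_self_entry_bound n y i Hy1 Hi). nra. }
      (* At [u0] each minorant is at most 0, so multiplying it by [s * y i], of absolute value at
         most 1, cannot bring it below itself. *)
      assert (H1 : sumR n (fun i => b i u0) <= s * sumR n (fun i => y i * b i u0)).
      { rewrite <- sumR_scal. apply sumR_le. intros i Hi.
        assert (b i u0 <= 0)
          by (pose proof (Hle i u0 Hi Hu0) as Hb; cbv beta in Hb; unfold b; lra).
        pose proof (Hys i Hi). nra. }
      (* The weights [1 + s * y i] are nonnegative, so the minorant inequalities survive
         weighting. *)
      assert (H2 : sumR n (fun i => (1 + s * y i) * b i u) <=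
                   sumR n (fun i => (1 + s * y i) * G i u + -1 * ((1 + s * y i) * G i u0))).
      { apply sumR_le. intros i Hi. pose proof (Hle i u Hi Hu) as Hb. cbv beta in Hb.
        pose proof (Hys i Hi). unfold b. nra. }
      rewrite sumR_plus, sumR_scal in H2.
      rewrite (sumR_ext n (fun i => (1 + s * y i) * b i u)
                 (fun i => b i u + s * (y i * b i u))) in H2 by (intros; ring).
      rewrite sumR_plus, sumR_scal, Hconst in H2. lra.
Qed.

(** * Compactness *)

(** [phi] need not be increasing: [m <= phi m] already preserves limits and is stable under the
    compositions used below. *)
Lemma Un_cv_subseq (f : nat -> R) l (phi : nat -> nat) :
  (forall m, (m <= phi m)%nat) -> Un_cv f l -> Un_cv (fun m => f (phi m)) l.
Proof.
  intros Hphi Hf eps Heps. destruct (Hf eps Heps) as (N & HN).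
  exists N. intros m Hm. apply HN. specialize (Hphi m). lia.
Qed.

Lemma bounded_subseq (f : nat -> R) :
  (forall m, -1 <= f m <= 1) ->
  exists (phi : nat -> nat) l,
    (forall m, (m <= phi m)%nat) /\ Un_cv (fun m => f (phi m)) l.
Proof.
  intros Hf.
  destruct (Bolzano_Weierstrass f (fun x => -1 <= x <= 1) (compact_P3 (-1) 1) Hf)
    as (l & Hl).
  assert (Hex : forall m, exists m', (m <= m')%nat /\ Rabs (f m' - l) < / INR (S m)).
  { intros m. assert (Hpos : 0 < / INR (S m)) by (apply Rinv_0_lt_compat, lt_0_INR; lia).
    destruct (Hl (disc l (mkposreal _ Hpos)) m) as (m' & Hm' & HV).
    - now exists (mkposreal _ Hpos).
    - exists m'. split; assumption. }
  pose (phi := fun m => proj1_sig (constructive_indefinite_description _ (Hex m))).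
  assert (Hphi : forall m, (m <= phi m)%nat /\ Rabs (f (phi m) - l) < / INR (S m)).
  { intros m. unfold phi. now destruct (constructive_indefinite_description _ (Hex m)). }
  exists phi, l. split; [apply Hphi|].
  intros eps Heps. destruct (archimed_cor1 eps Heps) as (N & HN & HN0).
  exists N. intros m Hm. unfold Rdist.
  apply Rlt_trans with (/ INR (S m)); [apply Hphi|].
  apply Rle_lt_trans with (/ INR N); [|exact HN].
  apply Rinv_le_contravar; [now apply lt_0_INR | apply le_INR; lia].
Qed.

Lemma bounded_subseq_vector N : forall x : nat -> nat -> R,
  (forall m i, (i < N)%nat -> -1 <= x m i <= 1) ->
  exists (phi : nat -> nat) (l : nat -> R),
    (forall m, (m <= phi m)%nat) /\
    (forall i, (i < N)%nat -> Un_cv (fun m => x (phi m) i) (l i)).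
Proof.
  induction N as [|N IH]; intros x Hx.
  - exists (fun m => m), (fun _ => 0). split; intros; lia.
  - destruct (IH x) as (phi & l & Hphi & Hl); [auto with arith|].
    destruct (bounded_subseq (fun m => x (phi m) N)) as (chi & a & Hchi & Ha);
      [auto with arith|].
    exists (fun m => phi (chi m)), (fun i => if Nat.eq_dec i N then a else l i). split.
    + intros m. specialize (Hchi m). specialize (Hphi (chi m)). lia.
    + intros i Hi. destruct (Nat.eq_dec i N) as [->|Hne]; [exact Ha|].
      apply (Un_cv_subseq (fun m => x (phi m) i)); [exact Hchi | apply Hl; lia].
Qed.

Lemma Un_cv_const a : Un_cv (fun _ => a) a.
Proof.
  intros eps Heps. exists 0%nat. intros m _. unfold Rdist.
  rewrite Rminus_diag, Rabs_R0. exact Heps.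
Qed.

Lemma Un_cv_sumR N (x : nat -> nat -> R) (l : nat -> R) :
  (forall i, (i < N)%nat -> Un_cv (fun m => x m i) (l i)) ->
  Un_cv (fun m => sumR N (x m)) (sumR N l).
Proof.
  induction N as [|N IH]; intros H; simpl; [apply Un_cv_const|].
  apply (CV_plus (fun m => sumR N (x m)) (fun m => x m N)); auto with arith.
Qed.

Lemma Un_cv_unique_const f l a : Un_cv f l -> (forall m, f m = a) -> l = a.
Proof.
  intros Hf Ha. apply (UL_sequence f); [exact Hf|].
  intros eps Heps. exists 0%nat. intros m _. unfold Rdist.
  rewrite Ha, Rminus_diag, Rabs_R0. exact Heps.
Qed.

Lemma approx_minimizer (C : (nat -> R) -> Prop) (f : (nat -> R) -> R) e :
  (exists u, C u) -> (forall u, C u -> 0 <= f u) -> 0 < e ->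
  exists u, C u /\ forall u', C u' -> f u <= f u' + e.
Proof.
  intros (u0 & H0) Hpos He.
  destruct (completeness (fun s => exists u, C u /\ s = - f u)) as (a & Hub & Hlub).
  - exists 0. intros s (u & Hu & ->). specialize (Hpos u Hu). lra.
  - now exists (- f u0), u0.
  - apply NNPP. intros Hno.
    (* If no point were [e]-optimal, [a - e] would still bound every [- f u], against the choice of
       [a] as supremum. *)
    assert (a <= a - e); [|lra].
    apply Hlub. intros s (u & Hu & ->).
    destruct (Rle_lt_dec (- f u) (a - e)) as [Hle|Hlt]; [exact Hle|].
    exfalso. apply Hno. exists u. split; [exact Hu|]. intros u' Hu'.
    assert (- f u' <= a) by (apply Hub; now exists u'). lra.
Qed.

(** * Perturbed distributions *)

Lemma dot_perturb n p s y x :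
  dot n (fun i => p i * (1 + s * y i)) x =
  dot n p x + s * dot n (fun i => p i * y i) x.
Proof.
  unfold dot. rewrite <- sumR_scal, <- sumR_plus. apply sumR_ext. intros; ring.
Qed.

Lemma simplex_perturb n p s y :
  simplex n p -> dot n y y = 1 -> dot n p y = 0 -> -1 <= s <= 1 ->
  simplex n (fun i => p i * (1 + s * y i)).
Proof.
  intros (Hin & Hpos & Hsum) Hy Hpy Hs. split; [|split].
  - intros i Hi. rewrite (Hin i Hi). ring.
  - intros i Hi. apply Rmult_le_pos; [now apply Hpos|].
    pose proof (dot_self_entry_bound n y i Hy Hi). nra.
  - rewrite (sumR_ext n _ (fun i => p i + s * (p i * y i))) by (intros; ring).
    rewrite sumR_plus, sumR_scal, Hsum. fold (dot n p y). rewrite Hpy. ring.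
Qed.

(** The loss of [t0] minus that of [t] is affine in [s], at most 0 at both ends and at least 0 at
    the midpoint, hence identically 0. So [t] is optimal at both ends, and by affinity on the whole
    segment. *)
Lemma trigger_set_perturb n k L p y t t0 s :
  simplex n p -> dot n y y = 1 -> dot n p y = 0 -> in_argmin n k L p t ->
  in_argmin n k L (fun i => p i * (1 + 1 * y i)) t0 ->
  in_argmin n k L (fun i => p i * (1 + -1 * y i)) t0 ->
  -1 <= s <= 1 ->
  trigger_set n k L t (fun i => p i * (1 + s * y i)).
Proof.
  intros Hp Hy Hpy (Htk & Ht) (Ht0k & Hplus) (_ & Hminus) Hs.
  split; [now apply simplex_perturb|]. split; [exact Htk|].
  intros t' Ht'.
  pose proof (Ht t0 Ht0k) as H0.
  pose proof (Hplus t Htk) as H1. pose proof (Hminus t Htk) as H2.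
  pose proof (Hplus t' Ht') as H3. pose proof (Hminus t' Ht') as H4.
  rewrite !dot_perturb in *. nra.
Qed.

Lemma lineality_perturb n k L p y t t0 :
  simplex n p -> dot n y y = 1 -> dot n p y = 0 -> in_argmin n k L p t ->
  in_argmin n k L (fun i => p i * (1 + 1 * y i)) t0 ->
  in_argmin n k L (fun i => p i * (1 + -1 * y i)) t0 ->
  feas_dirs n (trigger_set n k L t) p (fun i => p i * y i) /\
  feas_dirs n (trigger_set n k L t) p (fun i => - (p i * y i)).
Proof.
  intros Hp Hy Hpy Ht Hplus Hminus.
  assert (Hin : forall i, (n <= i)%nat -> p i = 0) by apply Hp.
  split; (split; [intros i Hi; rewrite (Hin i Hi); ring|]);
    exists 1; (split; [lra|]); intros eps Heps.
  - replace (fun i => p i + eps * (p i * y i)) with (fun i => p i * (1 + eps * y i))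
      by (apply functional_extensionality; intros; ring).
    apply trigger_set_perturb with t0; auto; lra.
  - replace (fun i => p i + eps * - (p i * y i)) with (fun i => p i * (1 + - eps * y i))
      by (apply functional_extensionality; intros; ring).
    apply trigger_set_perturb with t0; auto; lra.
Qed.

(** * Passing to the limit through calibration *)

(** Calibration at the limit distribution supplies a [u] with risk below [c]. Near-optimality
    against this [u] eventually pushes the risk of [U m] below [c] as well, which excludes a wrong
    prediction. Only the products [p i * psi (U m) i] need a uniform bound. *)
Lemma calibrated_eventually_optimal n k L C psi pred p (U : nat -> nat -> R)
    (Y : nat -> nat -> R) y B s :
  simplex n p -> dot n y y = 1 -> dot n p y = 0 -> -1 <= s <= 1 ->
  (forall q, simplex n q ->
      exists c : R,
        (exists u, C u /\ dot n q (psi u) < c) /\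
        (forall u, C u -> ~ in_argmin n k L q (pred u) -> c <= dot n q (psi u))) ->
  (forall m, C (U m)) ->
  (forall m i, (i < n)%nat -> 0 <= p i * psi (U m) i <= B) ->
  (forall i, (i < n)%nat -> Un_cv (fun m => Y m i) (y i)) ->
  (forall u, C u -> exists e : nat -> R, Un_cv e 0 /\ forall m,
     dot n (fun i => p i * (1 + s * Y m i)) (psi (U m)) <=
     dot n (fun i => p i * (1 + s * Y m i)) (psi u) + e m) ->
  exists N, forall m, (N <= m)%nat ->
    in_argmin n k L (fun i => p i * (1 + s * y i)) (pred (U m)).
Proof.
  intros Hp Hy Hpy Hs Hcal HU HB HY Hopt.
  pose (q := fun i => p i * (1 + s * y i)).
  destruct (Hcal q (simplex_perturb n p s y Hp Hy Hpy Hs)) as (c & (u & Hu & Hc) & Hpred).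
  destruct (Hopt u Hu) as (e & He & Hle).
  (* The risk of [u] at the m-th distribution, plus the cost of exchanging [Y m] for its limit in
     the risk of [U m], plus the optimality error. *)
  pose (bound := fun m =>
    sumR n (fun i => p i * (1 + s * Y m i) * psi u i + B * Rabs (Y m i - y i)) + e m).
  assert (Hlim : Un_cv bound (dot n q (psi u))).
  { replace (dot n q (psi u)) with
      (sumR n (fun i => p i * (1 + s * y i) * psi u i + B * Rabs (y i - y i)) + 0).
    - apply (CV_plus (fun m => sumR n (fun i =>
        p i * (1 + s * Y m i) * psi u i + B * Rabs (Y m i - y i))) e); [|exact He].
      apply (Un_cv_sumR n
        (fun m i => p i * (1 + s * Y m i) * psi u i + B * Rabs (Y m i - y i))).
      intros i Hi.
      apply (CV_plus (fun m => p i * (1 + s * Y m i) * psi u i)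
                     (fun m => B * Rabs (Y m i - y i))).
      + apply (CV_mult (fun m => p i * (1 + s * Y m i)) (fun _ => psi u i));
          [|apply Un_cv_const].
        apply (CV_mult (fun _ => p i) (fun m => 1 + s * Y m i)); [apply Un_cv_const|].
        apply (CV_plus (fun _ => 1) (fun m => s * Y m i)); [apply Un_cv_const|].
        apply (CV_mult (fun _ => s) (fun m => Y m i)); [apply Un_cv_const | now apply HY].
      + apply (CV_mult (fun _ => B) (fun m => Rabs (Y m i - y i))); [apply Un_cv_const|].
        apply (cv_cvabs (fun m => Y m i - y i)).
        apply (CV_minus (fun m => Y m i) (fun _ => y i)); [now apply HY | apply Un_cv_const].
    - rewrite Rplus_0_r. apply sumR_ext. intros i _.
      rewrite Rminus_diag, Rabs_R0. unfold q. ring. }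
  destruct (Hlim (c - dot n q (psi u))) as (N & HN); [lra|].
  exists N. intros m Hm. specialize (HN m Hm). unfold Rdist in HN.
  apply Rabs_def2 in HN.
  apply NNPP. intros Hno. specialize (Hpred (U m) (HU m) Hno).
  assert (dot n q (psi (U m)) <= bound m); [|lra].
  specialize (Hle m).
  assert (Hdiff : dot n q (psi (U m)) <=
            sumR n (fun i => p i * (1 + s * Y m i) * psi (U m) i + B * Rabs (Y m i - y i))).
  { apply sumR_le. intros i Hi. unfold q. specialize (HB m i Hi).
    assert (Hab : s * (y i - Y m i) <= Rabs (Y m i - y i)).
    { unfold Rabs. destruct (Rcase_abs (Y m i - y i)); nra. }
    pose proof (Rabs_pos (Y m i - y i)).
    assert (p i * psi (U m) i * (s * (y i - Y m i)) <= B * Rabs (Y m i - y i)).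
    { apply Rle_trans with (p i * psi (U m) i * Rabs (Y m i - y i));
        [apply Rmult_le_compat_l | apply Rmult_le_compat_r]; lra. }
    lra. }
  rewrite sumR_plus in Hdiff. unfold bound. rewrite sumR_plus.
  unfold dot in Hle. lra.
Qed.

(** The near-minimizers do not depend on the sign of the perturbation, so one prediction serves both
    ends. The extra 1 in the count pays for the equation [dot n p y = 0]. *)
Lemma common_optimal_direction n k L d C psi pred p E B :
  simplex n p ->
  (forall u, C u -> in_Rn d u) -> convex_set C -> convex_surrogate n C psi ->
  (forall q, simplex n q ->
      exists c : R,
        (exists u, C u /\ dot n q (psi u) < c) /\
        (forall u, C u -> ~ in_argmin n k L q (pred u) -> c <= dot n q (psi u))) ->
  (E + 1 + d < nnz n p)%nat ->
  exists y t0,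
    (forall i, (i < n)%nat -> p i = 0 -> y i = 0) /\ dot n y y = 1 /\
    dot n p y = 0 /\ (forall r, (r < E)%nat -> dot n (B r) y = 0) /\
    in_argmin n k L (fun i => p i * (1 + 1 * y i)) t0 /\
    in_argmin n k L (fun i => p i * (1 + -1 * y i)) t0.
Proof.
  intros Hp Hd HC (Hpsi & Hconv) Hcal HE.
  assert (Hp0 : forall i, (i < n)%nat -> 0 <= p i) by apply Hp.
  assert (HGpos : forall u i, C u -> (i < n)%nat -> 0 <= p i * psi u i).
  { intros u i Hu Hi. apply Rmult_le_pos; [now apply Hp0|].
    now apply (proj2 (Hpsi u Hu)). }
  assert (Hne : exists u, C u).
  { destruct (Hcal p Hp) as (c & (u & Hu & _) & _). now exists u. }
  (* Row 0 keeps the total mass of the perturbed distribution equal to 1. *)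
  pose (B' := fun r => match r with O => p | S r' => B r' end).
  pose (e := fun m => / INR (S m)).
  assert (He : forall m, 0 < e m).
  { intros m. apply Rinv_0_lt_compat, lt_0_INR. lia. }
  assert (Hstep : forall m, exists uy : (nat -> R) * (nat -> R),
    C (fst uy) /\
    (forall u, C u -> dot n p (psi (fst uy)) <= dot n p (psi u) + e m) /\
    (forall i, p i = 0 -> snd uy i = 0) /\ dot n (snd uy) (snd uy) = 1 /\
    (forall r, (r < S E)%nat -> dot n (B' r) (snd uy) = 0) /\
    (forall s u, -1 <= s <= 1 -> C u ->
       dot n (fun i => p i * (1 + s * snd uy i)) (psi (fst uy)) <=
       dot n (fun i => p i * (1 + s * snd uy i)) (psi u) + 2 * e m)).
  { intros m.
    destruct (approx_minimizer C (fun u => dot n p (psi u)) (e m) Hne) as (u0 & Hu0 & Hopt).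
    - intros u Hu. apply sumR_nonneg. intros i Hi. now apply HGpos.
    - apply He.
    - destruct (near_optimal_direction d C n (fun i u => p i * psi u i) u0 (e m) p (S E) B')
        as (y & Hy0 & Hy1 & HyB & Hys); auto; [|lia|].
      + intros i Hi u w lam Hu Hw Hl.
        pose proof (Hconv i Hi u w lam Hu Hw Hl). pose proof (Hp0 i Hi). nra.
      + exists (u0, y); simpl. do 5 (split; [assumption|]).
        intros s u Hs Hu. specialize (Hys s u Hs Hu).
        assert (Heq : forall x, dot n (fun i => p i * (1 + s * y i)) x =
                        sumR n (fun i => (1 + s * y i) * (p i * x i)))
          by (intros x; apply sumR_ext; intros; ring).
        rewrite !Heq. exact Hys. }
  pose (UY := fun m => proj1_sig (constructive_indefinite_description _ (Hstep m))).
  assert (HUY := fun m => proj2_sig (constructive_indefinite_description _ (Hstep m))).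
  change (forall m, _) with (forall m,
    C (fst (UY m)) /\
    (forall u, C u -> dot n p (psi (fst (UY m))) <= dot n p (psi u) + e m) /\
    (forall i, p i = 0 -> snd (UY m) i = 0) /\ dot n (snd (UY m)) (snd (UY m)) = 1 /\
    (forall r, (r < S E)%nat -> dot n (B' r) (snd (UY m)) = 0) /\
    (forall s u, -1 <= s <= 1 -> C u ->
       dot n (fun i => p i * (1 + s * snd (UY m) i)) (psi (fst (UY m))) <=
       dot n (fun i => p i * (1 + s * snd (UY m) i)) (psi u) + 2 * e m)) in HUY.
  clearbody UY.
  destruct (bounded_subseq_vector n (fun m => snd (UY m))) as (phi & y & Hphi & Hy).
  { intros m i Hi. apply (dot_self_entry_bound n); [apply HUY | exact Hi]. }
  assert (Hyy : dot n y y = 1).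
  { apply (Un_cv_unique_const (fun m => dot n (snd (UY (phi m))) (snd (UY (phi m)))));
      [|intros m; apply HUY].
    apply (Un_cv_sumR n (fun m i => snd (UY (phi m)) i * snd (UY (phi m)) i)).
    intros i Hi.
    apply (CV_mult (fun m => snd (UY (phi m)) i) (fun m => snd (UY (phi m)) i));
      now apply Hy. }
  assert (HyB : forall r, (r < S E)%nat -> dot n (B' r) y = 0).
  { intros r Hr. apply (Un_cv_unique_const (fun m => dot n (B' r) (snd (UY (phi m)))));
      [|intros m; now apply HUY].
    apply (Un_cv_sumR n (fun m i => B' r i * snd (UY (phi m)) i)). intros i Hi.
    apply (CV_mult (fun _ => B' r i) (fun m => snd (UY (phi m)) i));
      [apply Un_cv_const | now apply Hy]. }
  assert (Hpy : dot n p y = 0) by (apply (HyB 0%nat); lia).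
  assert (Hpred : forall s, -1 <= s <= 1 -> exists N, forall m, (N <= m)%nat ->
            in_argmin n k L (fun i => p i * (1 + s * y i)) (pred (fst (UY (phi m))))).
  { intros s Hs. destruct Hne as (ua & Hua).
    (* The bound comes from comparison with the fixed point [ua], the optimality error being at most
       1. *)
    apply (calibrated_eventually_optimal n k L C psi pred p (fun m => fst (UY (phi m)))
             (fun m => snd (UY (phi m))) y (dot n p (psi ua) + 1)); auto.
    - intros m. apply HUY.
    - intros m i Hi. destruct (HUY (phi m)) as (HCm & Hoptm & _).
      split; [now apply HGpos|].
      apply Rle_trans with (dot n p (psi (fst (UY (phi m))))).
      + apply (sumR_ge_term n (fun j => p j * psi (fst (UY (phi m))) j));
          [intros j Hj; now apply HGpos | exact Hi].
      + specialize (Hoptm ua Hua).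
        assert (e (phi m) <= 1); [|lra].
        unfold e. rewrite <- Rinv_1. apply Rinv_le_contravar; [lra|].
        rewrite S_INR. pose proof (pos_INR (phi m)). lra.
    - intros u Hu. exists (fun m => 2 * e (phi m)). split.
      + replace 0 with (2 * 0) by ring.
        apply (CV_mult (fun _ => 2) (fun m => e (phi m))); [apply Un_cv_const|].
        apply (Un_cv_subseq e 0 phi Hphi).
        intros eps Heps. destruct (archimed_cor1 eps Heps) as (N & HN & HN0).
        exists N. intros m Hm. unfold Rdist.
        rewrite Rminus_0_r, Rabs_pos_eq by (apply Rlt_le, He).
        apply Rle_lt_trans with (/ INR N); [|exact HN].
        apply Rinv_le_contravar; [now apply lt_0_INR | apply le_INR; lia].
      + intros m. now apply HUY. }
  destruct (Hpred 1) as (N1 & HN1); [lra|].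
  destruct (Hpred (-1)) as (N2 & HN2); [lra|].
  (* The index [N1 + N2] lies past both thresholds. *)
  exists y, (pred (fst (UY (phi (N1 + N2)%nat)))).
  split; [|split; [exact Hyy|]; split; [exact Hpy|]; split; [|split]].
  - intros i Hi Hpi. apply (Un_cv_unique_const (fun m => snd (UY (phi m)) i));
      [now apply Hy | intros m; now apply HUY].
  - intros r Hr. apply (HyB (S r)). lia.
  - apply HN1. lia.
  - apply HN2. lia.
Qed.

(** * Dimension count and conclusion *)

(** Pairing a vanishing combination with [y] kills the terms of [w] and leaves
    [c mu * dot n v y = 0], so the coefficient of [v] vanishes. *)
Lemma dim_ge_extend (S : (nat -> R) -> Prop) n mu w v y :
  (forall j, (j < mu)%nat -> S (w j)) -> lin_indep mu w -> S v ->
  (forall j, (j < mu)%nat -> dot n (w j) y = 0) -> dot n v y <> 0 ->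
  dim_ge S (mu + 1).
Proof.
  intros HS Hw Hv Hort Hvy.
  exists (fun j => if Nat.eq_dec j mu then v else w j). split.
  - intros j Hj. destruct (Nat.eq_dec j mu); [exact Hv | apply HS; lia].
  - intros c. rewrite Nat.add_1_r. simpl. intros Hc.
    destruct (Nat.eq_dec mu mu) as [_|]; [|lia].
    assert (Hc' : forall i, sumR mu (fun j => c j * w j i) + c mu * v i = 0).
    { intros i. rewrite <- (Hc i). f_equal. apply sumR_ext. intros j Hj.
      destruct (Nat.eq_dec j mu); [lia | reflexivity]. }
    assert (Hcmu : c mu = 0).
    { assert (H : sumR n (fun i => (sumR mu (fun j => c j * w j i) + c mu * v i) * y i) = 0)
        by (apply sumR_zero; intros i _; rewrite Hc'; ring).
      rewrite (sumR_ext n _ (fun i => sumR mu (fun j => c j * (w j i * y i))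
                                      + c mu * (v i * y i))) in H.
      - rewrite sumR_plus, sumR_exchange, sumR_scal, sumR_zero in H.
        + fold (dot n v y) in H. rewrite Rplus_0_l in H.
          now apply Rmult_integral in H as [|].
        + intros j Hj. rewrite sumR_scal. fold (dot n (w j) y).
          rewrite Hort by exact Hj. ring.
      - intros i _. rewrite Rmult_plus_distr_r, (Rmult_comm (sumR _ _)), <- sumR_scal.
        f_equal; [apply sumR_ext; intros|]; ring. }
    intros j Hj. destruct (Nat.eq_dec j mu) as [->|]; [exact Hcmu|].
    apply Hw; [|lia]. intros i. specialize (Hc' i). rewrite Hcmu in Hc'. lra.
Qed.

(* CCdim(L) >= ||p||_0 - mu_{Q_t}(p) - 1, i.e. every feasible dimension d
   (hence the least one, and trivially infinity) is >= the bound. *)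
Theorem mainTheorem11 (n k : nat) (L : nat -> nat -> R)
  (HL : nonneg_loss n k L) (Hstand : standing_assumption n k L)
  (p : nat -> R) (t : nat) (Hp : simplex n p) (Ht : in_argmin n k L p t)
  (mu : nat) (Hmu : is_mu n (trigger_set n k L t) p mu)
  (d : nat) (Hd : CC_feasible n k L d) :
  (Z.of_nat (nnz n p) - Z.of_nat mu - 1 <= Z.of_nat d)%Z.
Proof.
  destruct (le_lt_dec (nnz n p) (mu + 1 + d)) as [Hle|Hlt]; [lia|exfalso].
  destruct Hd as (C & psi & HCd & HC & Hpsi & pred & _ & Hcal).
  destruct Hmu as ((w & Hw & Hind) & Hmax).
  destruct (common_optimal_direction n k L d C psi pred p mu w)
    as (y & t0 & Hy0 & Hyy & Hpy & Hort & Hplus & Hminus); auto.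
  apply Hmax.
  apply (dim_ge_extend _ n mu w (fun i => p i * y i) y); auto.
  - now apply lineality_perturb with t0.
  - assert (Hp0 : forall i, (i < n)%nat -> 0 <= p i) by apply Hp.
    (* Here [dot n v y] is the sum of [p i * y i * y i]; were it zero, [y] would vanish on the
       support of [p], hence everywhere, against its unit norm. *)
    intros Hz.
    assert (Hall : dot n y y = 0); [|lra].
    apply sumR_zero. intros i Hi.
    assert (Hterm : p i * y i * y i <= 0).
    { rewrite <- Hz. apply (sumR_ge_term n (fun j => p j * y j * y j)); [|exact Hi].
      intros j Hj. specialize (Hp0 j Hj). nra. }
    specialize (Hp0 i Hi).
    destruct (Req_dec (p i) 0) as [Hpi|Hpi]; [rewrite Hy0 by assumption; ring|].
    nra.
Qed.
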